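(* Let $(X,d)$ be a CAT(0) cubical complex, let $A \subset X$ be a nonempty finite set, and let $\bar x \in X \setminus A$. Suppose that $\bar x$ lies in the relative interior of a maximal cell $C$ with ambient Euclidean space $E$. (1) For each $a \in A$, for all sufficiently small $t_a \in (0,1]$ the point $x_a = (1-t_a)\bar x + t_a a$ (on the geodesic $[\bar x,a]$ in $X$) lies in $C$. (2) For each $a \in A$ fix any value $t_a \in (0,1]$ such that $x_a = (1-t_a)\bar x + t_a a$ lies in $C$, and define the point $z_a = \bar x + \frac{1}{t_a}(x_a - \bar x)$ in $E$. Then $$\mathrm{def}_A(\bar x) \ =\ \min\Big\{ |z - \bar x| : z = \sum_{a \in A} w_a z_a,\ z \in E,\ w \in \Delta^A \Big\}.$$ (3) Let $(\hat z,\hat w) \in E \times \Delta^A$ be any pair attaining this minimum. If $\mathrm{def}_A(\bar x) = 0$, then $\bar x \in \mathrm{mean}(A)$, and this property is certified by $\hat w$. If $\mathrm{def}_A(\bar x) > 0$, then $\bar x \notin \mathrm{mean}(A)$, and this property is certified by the point $(1-t)\bar x + t\hat z$ (computed in $E$) for all sufficiently small $t > 0$.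
   Context: A CAT(0) cubical complex is a Hadamard space (complete CAT(0) geodesic space) $(X,d)$ that is a union of distinguished subsets called cells. Each cell $C$ is identified isometrically with a cube with sides of unit length in some ambient Euclidean space $E$, and via this identification inherits faces and a relative interior. Each face of a cell is a cell; any two cells are either disjoint or glued together along a unique common face. A cell is maximal if it is not contained in a strictly larger cell. The metric $d$ is the intrinsic (length) metric induced by the Euclidean distance on each cell. For points $u,v\in X$ and $t\in[0,1]$, $(1-t)u+tv$ denotes the point on the geodesic $[u,v]$ at distance $t\,d(u,v)$ from $u$. Let $\Delta^A = \{ w \in \mathbb{R}^A : w_a \ge 0 \ \forall a\in A,\ \sum_{a \in A} w_a = 1\}$. $\mathrm{mean}(A)$ is the set of points $\bar x \in X$ for which there is $w \in \Delta^A$ such that $\bar x$ minimizes $x \mapsto \sum_{a\in A} w_a d(a,x)^2$ over $X$; such a $w$ is said to certify the property $\bar x \in \mathrm{mean}(A)$. A point $x \in X$ certifies the property $\bar x \notin \mathrm{mean}(A)$ if $d(a,x) < d(a,\bar x)$ for all $a \in A$. For $\bar x\notin A$, the mean deficit is $\mathrm{def}_A(\bar x) = \big( \sup_{y \in X,\, y \ne \bar x} \min_{a \in A} \{ d(a,\bar x) \cos\angle a \bar x y \} \big)^+$, where $\angle$ is the Alexandrov angle and $\alpha^+=\max\{\alpha,0\}$. *)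

(* Defs.v *)
From HB Require Import structures.
From mathcomp Require Import all_boot all_order all_algebra finmap.
From mathcomp Require Import all_classical all_reals all_analysis.

Set Implicit Arguments.
Unset Strict Implicit.
Unset Printing Implicit Defensive.

Import Order.TTheory GRing.Theory Num.Theory.
Import numFieldNormedType.Exports.

Local Open Scope classical_set_scope.
Local Open Scope ring_scope.

(* The library norm [`|u|] on ['rV[R]_n] is the sup norm, so the Euclidean
   norm of R^n has to be introduced. *)
Definition enorm (R : realType) (n : nat) (u : 'rV[R]_n) : R :=
  Num.sqrt (\sum_i (u 0 i) ^+ 2).

Definition affine_hull (R : realType) (n : nat) (S : set 'rV[R]_n) :
    set 'rV[R]_n :=
  [set y | exists (k : nat) (u : 'I_k -> 'rV[R]_n) (l : 'I_k -> R),
    [/\ forall i, S (u i), \sum_i l i = 1 & y = \sum_i l i *: u i]].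

Definition relint (R : realType) (n : nat) (S : set 'rV[R]_n) :
    set 'rV[R]_n :=
  [set x | S x /\ exists2 e : R, 0 < e &
    forall y, affine_hull S y -> enorm (y - x) < e -> S y].

(* A cube with unit sides, of any dimension [cube_dim], in a Euclidean space of
   any dimension [cube_amb]: the orthonormal rows of [cube_edges] are its edge
   vectors at the corner [cube_origin]. *)
Record unit_cube (R : realType) := UnitCube {
  cube_amb : nat;
  cube_dim : nat;
  cube_origin : 'rV[R]_cube_amb;
  cube_edges : 'M[R]_(cube_dim, cube_amb);
  cube_orthonormal : cube_edges *m cube_edges^T = 1%:M
}.

(* [J i = Some b] fixes the i-th cube coordinate to [b] (0 or 1), and
   [J i = None] leaves it free in [0, 1]. *)
Definition cube_face (R : realType) (Q : unit_cube R)
    (J : 'I_(cube_dim Q) -> option bool) : set 'rV[R]_(cube_amb Q) :=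
  [set cube_origin Q + s *m cube_edges Q | s in
    [set s : 'rV[R]_(cube_dim Q) | forall i,
      0 <= s 0 i <= 1 /\ (forall b : bool, J i = Some b -> s 0 i = b%:R)]].

Definition cube_set (R : realType) (Q : unit_cube R) :
    set 'rV[R]_(cube_amb Q) :=
  cube_face (fun=> None).

Section metric_geometry.
Context {R : realType} {X : metricType R}.
Implicit Types (p u v x y z : X) (A : {fset X}).

(* Constant-speed geodesics; only the values of [g] on [0, 1] matter. *)
Definition geodesic u v : set (R -> X) :=
  [set g | [/\ g 0 = u, g 1 = v &
    forall s t : R, 0 <= s <= 1 -> 0 <= t <= 1 ->
      mdist (g s) (g t) = `|s - t| * mdist u v]].

(* The CAT(0) inequality for two sides of a geodesic triangle [x, y, z]; any two
   distinct sides share a vertex, here named [x]. *)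
Definition cat0_inequality : Prop :=
  forall x y z (g h : R -> X) (x' y' z' : 'rV[R]_2),
    geodesic x y g -> geodesic x z h ->
    enorm (x' - y') = mdist x y ->
    enorm (x' - z') = mdist x z ->
    enorm (y' - z') = mdist y z ->
    forall s t : R, 0 <= s <= 1 -> 0 <= t <= 1 ->
      mdist (g s) (h t) <=
        enorm (((1 - s) *: x' + s *: y') - ((1 - t) *: x' + t *: z')).

(* [geodesic_point u v t] is (1 - t) u + t v; geodesics are unique in a
   Hadamard space, so the choice of [g] is immaterial there. *)
Definition geodesic_point u v : R -> X := xget (fun=> u) (geodesic u v).

Definition comparison_angle u p v : R :=
  acos ((mdist p u ^+ 2 + mdist p v ^+ 2 - mdist u v ^+ 2) /
        (2 * mdist p u * mdist p v)).

(* The angle at [p] between the geodesics from [p] to [u] and from [p] to [v]. *)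
Definition alexandrov_angle u p v : R :=
  fine (limf_esup
    (fun st : R * R =>
       (comparison_angle (geodesic_point p u st.1) p
                         (geodesic_point p v st.2))%:E)
    (filter_prod (0 : R)^'+ (0 : R)^'+)).

Definition simplex A : set (A -> R) :=
  [set w | (forall a, 0 <= w a) /\ \sum_(a : A) w a = 1].

Definition certifies_mean A x (w : A -> R) : Prop :=
  simplex w /\
  forall y, \sum_(a : A) w a * mdist (val a) x ^+ 2 <=
            \sum_(a : A) w a * mdist (val a) y ^+ 2.

Definition mean A : set X := [set x | exists w, certifies_mean (A := A) x w].

(* [y] certifies that [x] is not in [mean A]. *)
Definition certifies_not_mean A x y : Prop :=
  forall a, a \in A -> mdist a y < mdist a x.

(* The [inf] is a minimum, over the finite set [A]. *)
Definition mean_deficit A x : R :=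
  Num.max
    (sup [set inf [set mdist a x * cos (alexandrov_angle a x y) | a in [set` A]]
         | y in [set y | y <> x]])
    0.

End metric_geometry.

Record hadamard (R : realType) (X : metricType R) : Prop := Hadamard {
  hadamard_complete :
    forall F : set_system X, ProperFilter F -> cauchy F -> exists x : X, F --> x;
  hadamard_geodesic : forall x y : X, exists g : R -> X, geodesic x y g;
  hadamard_cat0 : cat0_inequality (X := X)
}.

(* [string_length K Q f x y l]: there is a chain of points from [x] to [y], any
   two consecutive ones lying in a common cell, of total Euclidean length [l].
   Here [K] is the set of cells, and [f C] identifies the cube [Q C] with the
   cell [C]. *)
Inductive string_length (R : realType) (X : metricType R) (K : set (set X))
    (Q : set X -> unit_cube R) (f : forall C, 'rV[R]_(cube_amb (Q C)) -> X) :
    X -> X -> R -> Prop :=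
| string_nil x : string_length K f x x 0
| string_cons C (u v : 'rV[R]_(cube_amb (Q C))) y l :
    K C -> cube_set u -> cube_set v ->
    string_length K f (f C v) y l ->
    string_length K f (f C u) y (enorm (u - v) + l).

(* [cell_cube C] and [cell_chart C] are relevant only for cells [C], and
   [cell_chart C] only on the cube. The last field says that the metric is the
   length metric induced by the Euclidean distances on the cells. *)
Record cat0_cubical_complex (R : realType) (X : metricType R) :=
  Cat0CubicalComplex {
  cells : set (set X);
  cell_cube : set X -> unit_cube R;
  cell_chart : forall C : set X, 'rV[R]_(cube_amb (cell_cube C)) -> X;
  complex_hadamard : hadamard X;
  cells_cover : \bigcup_(C in cells) C = setT;
  cell_chart_image :
    forall C, cells C -> cell_chart (C := C) @` cube_set (Q := cell_cube C) = C;
  cell_chart_isometry : forall C (u v : 'rV[R]_(cube_amb (cell_cube C))),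
    cells C -> cube_set u -> cube_set v ->
    mdist (cell_chart u) (cell_chart v) = enorm (u - v);
  cells_face : forall C (J : 'I_(cube_dim (cell_cube C)) -> option bool),
    cells C -> cells (cell_chart (C := C) @` cube_face J);
  cells_glue : forall C D, cells C -> cells D ->
    C `&` D = set0 \/
    exists (J : 'I_(cube_dim (cell_cube C)) -> option bool)
           (L : 'I_(cube_dim (cell_cube D)) -> option bool),
      C `&` D = cell_chart (C := C) @` cube_face J /\
      C `&` D = cell_chart (C := D) @` cube_face L;
  metric_intrinsic : forall x y : X,
    ((mdist x y)%:E =
     ereal_inf [set l%:E | l in string_length cells cell_chart x y])%E
}.

Section cells.
Context {R : realType} {X : metricType R} (K : cat0_cubical_complex X).
Implicit Types (C : set X).

Definition maximal_cell C : Prop :=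
  cells K C /\ forall D, cells K D -> C `<=` D -> D = C.

Definition cell_relint C : set X :=
  cell_chart (c := K) (C := C) @` relint (cube_set (Q := cell_cube K C)).

(* The point of the cube identified with [x]; meaningful when [C x]. *)
Definition cell_coord C (x : X) : 'rV[R]_(cube_amb (cell_cube K C)) :=
  xget 0 [set u | cube_set u /\ cell_chart u = x].

End cells.

(* Main.v *)
(* Near xbar the space is a Euclidean ball: a string of small length starting
   in the relative interior of a maximal cell cannot leave that cell, so a
   small metric ball around xbar lies in C. Every point y then has a log
   vector, the initial velocity of the geodesic from xbar to y. Alexandrov
   angles at xbar are Euclidean angles between log vectors, and by the CAT(0)
   inequality the logarithm is 1-Lipschitz. Since z_a - xbar is the log vector
   of a, the mean deficit is sup over unit vectors e of min_a <z_a - xbar, e>,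
   which by the variational inequality for the point p of least norm in the
   convex hull of the log vectors equals |p|. If p = 0, expanding |log a - log
   y|^2 <= d(a, y)^2 shows that xbar is a mean; if p <> 0, moving xbar
   slightly along p decreases every d(a, .). *)

Require Import Defs.
From HB Require Import structures.
From mathcomp Require Import all_boot all_order all_algebra finmap.
From mathcomp Require Import all_classical all_reals all_analysis.
From mathcomp Require Import ring lra.

Set Implicit Arguments.
Unset Strict Implicit.
Unset Printing Implicit Defensive.

Import Order.TTheory GRing.Theory Num.Theory.
Import numFieldNormedType.Exports.

Local Open Scope classical_set_scope.
Local Open Scope ring_scope.

(** * The Euclidean inner product and norm on row vectors *)

Section euclidean.
Context {R : realType} {n : nat}.
Implicit Types (u v w : 'rV[R]_n) (c : R).

Definition dotv u v : R := (u *m v^T) 0 0.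

Lemma dotvC u v : dotv u v = dotv v u.
Proof. by rewrite /dotv -[u in LHS]trmxK -trmx_mul mxE. Qed.

Lemma dotvDl u v w : dotv (u + v) w = dotv u w + dotv v w.
Proof. by rewrite /dotv mulmxDl mxE. Qed.

Lemma dotvZl c u v : dotv (c *: u) v = c * dotv u v.
Proof. by rewrite /dotv -scalemxAl mxE. Qed.

Lemma dotvDr u v w : dotv u (v + w) = dotv u v + dotv u w.
Proof. by rewrite dotvC dotvDl ![dotv _ u]dotvC. Qed.

Lemma dotvZr c u v : dotv u (c *: v) = c * dotv u v.
Proof. by rewrite dotvC dotvZl dotvC. Qed.

Lemma dotvNl u v : dotv (- u) v = - dotv u v.
Proof. by rewrite -scaleN1r dotvZl mulN1r. Qed.

Lemma dotvNr u v : dotv u (- v) = - dotv u v.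
Proof. by rewrite dotvC dotvNl dotvC. Qed.

Lemma dot0v u : dotv 0 u = 0.
Proof. by rewrite -(scale0r u) dotvZl mul0r. Qed.

Lemma dotv_suml (I : finType) (F : I -> 'rV[R]_n) v :
  dotv (\sum_i F i) v = \sum_i dotv (F i) v.
Proof. by rewrite /dotv mulmx_suml summxE. Qed.

Lemma dotvv u : dotv u u = \sum_i u 0 i ^+ 2.
Proof. by rewrite /dotv mxE; apply: eq_bigr => i _; rewrite mxE expr2. Qed.

Lemma dotvv_ge0 u : 0 <= dotv u u.
Proof. by rewrite dotvv sumr_ge0// => i _; exact: sqr_ge0. Qed.

Lemma enorm_ge0 u : 0 <= enorm u.
Proof. exact: sqrtr_ge0. Qed.

Lemma sqr_enorm u : enorm u ^+ 2 = dotv u u.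
Proof. by rewrite /enorm sqr_sqrtr -?dotvv// dotvv_ge0. Qed.

Lemma enormE u : enorm u = Num.sqrt (dotv u u).
Proof. by rewrite dotvv. Qed.

Lemma enormN u : enorm (- u) = enorm u.
Proof. by rewrite !enormE dotvNl dotvNr opprK. Qed.

Lemma enormZ c u : enorm (c *: u) = `|c| * enorm u.
Proof.
by rewrite !enormE dotvZl dotvZr mulrA -expr2 sqrtrM ?sqr_ge0// sqrtr_sqr.
Qed.

Lemma enormZ_ge0 c u : 0 <= c -> enorm (c *: u) = c * enorm u.
Proof. by move=> c0; rewrite enormZ ger0_norm. Qed.

Lemma enorm0 : enorm (0 : 'rV[R]_n) = 0.
Proof. by rewrite enormE dot0v sqrtr0. Qed.

Lemma enorm_coord u i : `|u 0 i| <= enorm u.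
Proof.
rewrite enormE -sqrtr_sqr ler_wsqrtr// dotvv (bigD1 i)//= lerDl.
by rewrite sumr_ge0// => j _; exact: sqr_ge0.
Qed.

Lemma enorm_eq0 u : enorm u = 0 -> u = 0.
Proof.
move=> u0; apply/rowP => i; rewrite mxE; apply/eqP.
by rewrite -normr_le0 -u0 enorm_coord.
Qed.

Lemma sqr_enormB u v :
  enorm (u - v) ^+ 2 = enorm u ^+ 2 + enorm v ^+ 2 - 2 * dotv u v.
Proof.
by rewrite !sqr_enorm dotvDl !dotvDr !dotvNl !dotvNr (dotvC v u); ring.
Qed.

(** Cauchy-Schwarz, from the nonnegativity of the square of [dotv v v *: u - dotv u v *: v], which
    factors as [dotv v v] times the Gram determinant. *)
Lemma dotv_le_enorm u v : dotv u v <= enorm u * enorm v.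
Proof.
have [v0|v0] := eqVneq (enorm v) 0.
  by rewrite v0 (enorm_eq0 v0) dotvC dot0v mulr0.
have v2 : 0 < dotv v v by rewrite -sqr_enorm exprn_gt0// lt0r v0 enorm_ge0.
have : 0 <= dotv v v * (dotv u u * dotv v v - dotv u v ^+ 2).
  have := dotvv_ge0 (dotv v v *: u - dotv u v *: v).
  rewrite !(dotvDl, dotvDr, dotvNl, dotvNr, dotvZl, dotvZr) (dotvC v u).
  by move=> /le_trans; apply; rewrite le_eqVlt; apply/orP; left; apply/eqP; ring.
rewrite pmulr_rge0// subr_ge0 -!sqr_enorm -exprMn => sq.
rewrite (le_trans (ler_norm _))// -ler_sqr ?nnegrE ?mulr_ge0 ?enorm_ge0//.
by rewrite real_normK ?num_real.
Qed.

Lemma norm_dotv_le u v : `|dotv u v| <= enorm u * enorm v.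
Proof.
by rewrite ler_norml dotv_le_enorm andbT lerNl -dotvNl -(enormN u) dotv_le_enorm.
Qed.

(* Strict convexity of the Euclidean norm: equality in the triangle inequality
   forces collinearity. *)
Lemma enorm_collinear s t d v w : 0 < t -> enorm v = t * d ->
  enorm w = s * d -> enorm (v - w) = (t - s) * d -> w = (s / t) *: v.
Proof.
move=> t0 vd wd vwd; apply/eqP; rewrite -subr_eq0; apply/eqP/enorm_eq0/eqP.
rewrite -sqrf_eq0 sqr_enormB enormZ !exprMn -normrX ger0_norm ?sqr_ge0//.
rewrite dotvZr; apply/eqP.
have := sqr_enormB v w; rewrite vd wd vwd (dotvC v w) => dvw.
have {dvw}-> : dotv w v = s * t * d ^+ 2 by lra.
by field; rewrite gt_eqF.
Qed.

End euclidean.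

Lemma enorm_mulmx (R : realType) n m (M : 'M[R]_(n, m)) (u : 'rV[R]_n) :
  M *m M^T = 1%:M -> enorm (u *m M) = enorm u.
Proof.
by move=> MM; rewrite !enormE /dotv trmx_mul mulmxA -(mulmxA u) MM mulmx1.
Qed.

(** * Comparison triangles in the plane *)

Section comparison_triangle.
Context {R : realType}.

Lemma comparison_triangle (p q m : R) : 0 <= p -> 0 <= q -> 0 <= m ->
  p <= q + m -> q <= p + m -> m <= p + q ->
  exists y z : 'rV[R]_2, [/\ enorm y = p, enorm z = q & enorm (y - z) = m].
Proof.
move=> p0 q0 m0 pqm qpm mpq.
(* With one vertex at the origin and [y] at [(p, 0)], the law of cosines gives this first coordinate
   of [z]. If [p = 0], division by zero makes [a] zero, which is consistent since then [q = m]. *)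
pose a := (p ^+ 2 + q ^+ 2 - m ^+ 2) / (2 * p).
have pa : 2 * p * a = p ^+ 2 + q ^+ 2 - m ^+ 2.
  have [pe|pn] := eqVneq p 0; last by rewrite /a mulrC divfK// mulf_neq0.
  have -> : q = m by apply/eqP; rewrite eq_le; lra.
  by rewrite pe; ring.
have a2q : a ^+ 2 <= q ^+ 2.
  have [pe|pn] := eqVneq p 0.
    by rewrite /a pe mulr0 invr0 mulr0 expr0n/= sqr_ge0.
  have p2 : 0 < 4 * p ^+ 2 by rewrite mulr_gt0// exprn_even_gt0.
  rewrite -(ler_pM2l p2) -subr_ge0.
  have -> : 4 * p ^+ 2 * q ^+ 2 - 4 * p ^+ 2 * a ^+ 2 =
      (2 * p * q) ^+ 2 - (2 * p * a) ^+ 2 by ring.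
  (* Heron's factorization of 16 times the squared area; each factor is nonnegative by a triangle
     inequality. *)
  rewrite pa (_ : _ - _ = ((p + q - m) * (p + q + m)) *
    ((m - p + q) * (m + p - q))); last by ring.
  by rewrite !mulr_ge0//; lra.
pose b := Num.sqrt (q ^+ 2 - a ^+ 2).
have b2 : b ^+ 2 = q ^+ 2 - a ^+ 2 by rewrite sqr_sqrtr// subr_ge0.
pose y : 'rV[R]_2 := \row_i (if i == 0 then p else 0).
pose z : 'rV[R]_2 := \row_i (if i == 0 then a else b).
have sum2 (c : R) (u : 'rV[R]_2) : 0 <= c ->
    u 0 0 ^+ 2 + u 0 1 ^+ 2 = c ^+ 2 -> enorm u = c.
  move=> c0 uc; rewrite enormE dotvv big_ord_recl big_ord1.
  by rewrite (_ : lift _ _ = 1) ?uc ?sqrtr_sqr ?ger0_norm//; apply/val_inj.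
by exists y, z; split; apply: sum2 => //; rewrite !mxE/=; lra.
Qed.

End comparison_triangle.

(** * Points of least norm in a convex hull *)

Lemma continuous_sum (R : realType) (T : topologicalType) (J : finType)
    (F : J -> T -> R) :
  (forall j, continuous (F j)) -> continuous (fun x => \sum_j F j x).
Proof.
move=> Fc; elim: (index_enum J) => [|j r IHr] x.
  by under eq_fun do rewrite big_nil; exact: cvg_cst.
under eq_fun do rewrite big_cons.
by apply: cvgD; [exact: Fc|exact: IHr].
Qed.

Section minimal_norm.
Context {R : realType} {n : nat} {I : finType}.
Context (u : I -> 'rV[R]_n).

Definition convex_weights (w : I -> R) : Prop :=
  (forall i, 0 <= w i) /\ \sum_i w i = 1.

Definition minimal_weights (w : I -> R) : Prop :=
  convex_weights w /\ forall w', convex_weights w' ->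
    enorm (\sum_i w i *: u i) <= enorm (\sum_i w' i *: u i).

(** The weights form a closed subset of a product of unit intervals, compact by Tychonoff, and the
    squared norm is continuous in the weights. The index [i0] makes the simplex nonempty. *)
Lemma minimal_weights_exist (i0 : I) : exists w, minimal_weights w.
Proof.
pose T := prod_topology (fun _ : I => R).
have pc (i : I) : continuous (fun w : T => w i) by exact: proj_continuous.
pose S : set T :=
  [set w | forall i, `[0, 1]%classic (w i)] `&` [set w | \sum_i w i = 1].
have SE w : S w <-> convex_weights w.
  split=> [[w01 w1]|[w0 w1]]; split=> // i.
    by have := w01 i; rewrite /= in_itv/= => /andP[].
  by rewrite /= in_itv/= w0 -w1 (bigD1 i)//= lerDl sumr_ge0.
have Sc : compact S.
  have bc : compact [set w : T | forall i, `[0, 1]%classic (w i)].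
    exact: (@tychonoff I (fun=> R) (fun=> `[0, 1]%classic)
      (fun=> @segment_compact R 0 1)).
  apply: (compact_closedI bc).
  pose g (w : T) := \sum_i w i.
  have gc : continuous g by exact: continuous_sum.
  by apply: (preimage_closed (f := g) _ (@closed_eq R 1)) => w _; exact: gc.
have S0 : S !=set0.
  exists (fun i => (i == i0)%:R); apply/SE; split=> [i|]; first exact: ler0n.
  by rewrite (bigD1 i0)//= eqxx big1 ?addr0// => i /negbTE ->.
pose f (w : T) := \sum_j (\sum_i w i * u i 0 j) ^+ 2.
have fE (w : T) : Num.sqrt (f w) = enorm (\sum_i w i *: u i).
  rewrite enormE dotvv; congr Num.sqrt; apply: eq_bigr => j _.
  by rewrite summxE; congr (_ ^+ 2); apply: eq_bigr => i _; rewrite mxE.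
have fc : continuous f.
  apply: continuous_sum => j w.
  have c : continuous (fun w : T => \sum_i w i * u i 0 j).
    apply: continuous_sum => i w'.
    exact: (cvgM (pc i w') (cvg_cst (u i 0 j))).
  exact: (cvgM (c w) (c w)).
have [w] := compact_EVT_min S0 Sc (continuous_subspaceT fc).
rewrite inE => /SE Sw wmin; exists w; split=> // w' /SE Sw'.
by rewrite -!fE ler_wsqrtr// wmin// inE.
Qed.

(** The variational inequality for the projection of the origin: if it failed, moving from [p]
    towards [u i] would shorten [p]. *)
Lemma minimal_weights_dotv (w : I -> R) (i : I) : minimal_weights w ->
  enorm (\sum_j w j *: u j) ^+ 2 <= dotv (u i) (\sum_j w j *: u j).
Proof.
move=> [[w0 w1] wmin]; set p := \sum_j w j *: u j.
rewrite leNgt; apply/negP; rewrite -subr_gt0 sqr_enorm => k0.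
set k := _ - _ in k0; set N := dotv (u i - p) (u i - p).
have N0 : 0 <= N := dotvv_ge0 _.
(* The squared norm at [p + t *: (u i - p)] is that of [p] plus [t * (t * N - 2 * k)]. This choice
   gives [t * N < k], so the norm drops, and it keeps [t <= 1], so the weights stay convex. *)
pose t := k / (k + N).
have kN : 0 < k + N by rewrite ltr_wpDr.
have t0 : 0 < t by rewrite divr_gt0.
have t1 : t <= 1 by rewrite ler_pdivrMr// mul1r lerDl.
have tN : t * (k + N) = k by rewrite divfK ?gt_eqF.
pose w' j := (1 - t) * w j + t * (j == i)%:R.
have cw' : convex_weights w'.
  split=> [j|].
    by apply: addr_ge0; apply: mulr_ge0 => //; rewrite ?subr_ge0 ?(ltW t0).
  rewrite /w' big_split/= -!mulr_sumr w1 (bigD1 i)//= eqxx big1 ?addr0.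
    by rewrite !mulr1 subrK.
  by move=> j /negbTE ->.
have w'E : \sum_j w' j *: u j = p + t *: (u i - p).
  transitivity ((1 - t) *: p + t *: u i).
    under eq_bigr do rewrite /w' scalerDl -(scalerA (1 - t)) -(scalerA t).
    rewrite big_split/= -scaler_sumr -/p -scaler_sumr; congr (_ + t *: _).
    rewrite (bigD1 i)//= eqxx scale1r big1 ?addr0// => j /negbTE ->.
    by rewrite scale0r.
  by rewrite scalerBr scalerBl scale1r -addrA [- _ + _]addrC.
have := wmin _ cw'; rewrite w'E -/p leNgt => /negP; apply.
rewrite -ltr_sqr ?nnegrE ?enorm_ge0// !sqr_enorm.
rewrite !(dotvDl p) !(dotvDr _ p) !(dotvZl, dotvZr) -/N (dotvC p (u i - p)).
have -> : dotv (u i - p) p = - k by rewrite dotvDl dotvNl /k; ring.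
nra.
Qed.

End minimal_norm.

(** * Limits along right neighbourhoods of 0 *)

Lemma near_right0_ltM (R : realType) (c e : R) : 0 < e ->
  \forall t \near 0^'+, t * c < e.
Proof.
move=> e0; have c1 : 0 < `|c| + 1 by rewrite ltr_wpDl.
have ec : 0 < e / (`|c| + 1) by rewrite divr_gt0.
near=> t; have t0 : 0 < t by near: t; exact: nbhs_right_gt.
have : t < e / (`|c| + 1) by near: t; exact: nbhs_right_lt.
rewrite ltr_pdivlMr//; apply: le_lt_trans; rewrite ler_wpM2l ?(ltW t0)//.
by rewrite (le_trans (ler_norm c))// lerDl.
Unshelve. all: by end_near. Qed.

(** The set where [f] equals [c] belongs to [F] and has supremum [c]; every other member of [F]
    meets it, so its supremum is at least [c]. This evaluates Alexandrov angles whose comparison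
    angles are eventually constant. *)
Lemma limf_esup_near_cst (R : realType) (T : choiceType) (Y : filteredType T)
    (f : Y -> \bar R) (F : set_system Y) (c : \bar R) :
  ProperFilter F -> (\forall y \near F, f y = c) -> limf_esup f F = c.
Proof.
move=> FF Fc; rewrite limf_esupE; apply/eqP; rewrite eq_le; apply/andP; split.
  apply: ereal_inf_lbound; exists [set y | f y = c] => //.
  have [y fy] := filter_ex Fc.
  rewrite (_ : f @` _ = [set c]) ?ereal_sup1//.
  by apply/seteqP; split=> [_ [z zc <-]//|_ ->]; exists y.
apply: le_ereal_inf_tmp => _ [V FV <-].
have [y [Vy fy]] := filter_ex (filterI FV Fc).
by rewrite -fy; apply: ereal_sup_ubound; exists y.
Qed.

(** * Geodesics in a Hadamard space *)

Section geodesics.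
Context {R : realType} {X : metricType R}.
Context (HX : hadamard X).
Implicit Types (x y z : X) (s t : R).

Lemma geodesic_pointP x y : geodesic x y (geodesic_point x y).
Proof. exact: (xgetPex _ (hadamard_geodesic HX x y)). Qed.

Lemma geodesic_point_dist x y s t : 0 <= s <= 1 -> 0 <= t <= 1 ->
  mdist (geodesic_point x y s) (geodesic_point x y t) = `|s - t| * mdist x y.
Proof. by have [_ _] := geodesic_pointP x y; apply. Qed.

Lemma geodesic_point0 x y : geodesic_point x y 0 = x.
Proof. by have [] := geodesic_pointP x y. Qed.

Lemma geodesic_point1 x y : geodesic_point x y 1 = y.
Proof. by have [] := geodesic_pointP x y. Qed.

Lemma geodesic_point_distl x y t : 0 <= t <= 1 ->
  mdist x (geodesic_point x y t) = t * mdist x y.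
Proof.
move=> t01; rewrite -{1}(geodesic_point0 x y) geodesic_point_dist ?lexx ?ler01//.
by rewrite sub0r normrN ger0_norm//; case/andP: t01.
Qed.

Lemma geodesic_point_distr x y t : 0 <= t <= 1 ->
  mdist y (geodesic_point x y t) = (1 - t) * mdist x y.
Proof.
move=> t01; rewrite -{1}(geodesic_point1 x y) geodesic_point_dist ?lexx ?ler01//.
by rewrite ger0_norm// subr_ge0; case/andP: t01.
Qed.

(** The CAT(0) inequality at equal parameters, for a comparison triangle with the vertex of [x] at
    the origin, where the planar segment scales exactly by [t]. *)
Lemma geodesic_point_contraction x y z t : 0 <= t <= 1 ->
  mdist (geodesic_point x y t) (geodesic_point x z t) <= t * mdist y z.
Proof.
move=> t01.
have [//||//|u [v [ux vx uv]]] := @comparison_triangle R (mdist x y) (mdist x z)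
  (mdist y z) (mdist_ge0 _ _) (mdist_ge0 _ _) (mdist_ge0 _ _).
- by rewrite (metric_sym y z) metric_triangle.
- by rewrite metric_triangle.
- by rewrite (metric_sym x y) metric_triangle.
have := @hadamard_cat0 _ _ HX x y z _ _ 0 u v (geodesic_pointP x y)
  (geodesic_pointP x z).
rewrite !sub0r !enormN => /(_ ux vx uv t t t01 t01).
rewrite scaler0 !add0r -scalerBr enormZ_ge0 ?uv//.
by case/andP: t01.
Qed.

End geodesics.

(** * The logarithm at a point with a Euclidean neighbourhood *)

Section euclidean_chart.
Context {R : realType} {X : metricType R} {n : nat}.
Context (HX : hadamard X).
(** An abstract form of the cell, with [x0] moved to the origin. [D] may be larger than the ball of
    radius [r]: it will be the whole cube, since the points chosen on the geodesics to [A] may lie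
    anywhere in the cell. *)
Context (x0 : X) (D : set 'rV[R]_n) (phi : 'rV[R]_n -> X) (r : R).
Context (r_gt0 : 0 < r) (phi0 : phi 0 = x0).
Context (ball_D : forall v, enorm v < r -> D v).
Context (phi_isometry : forall v w, D v -> D w ->
  mdist (phi v) (phi w) = enorm (v - w)).
Context (phi_onto : forall y, mdist x0 y < r -> exists2 v, D v & phi v = y).
Implicit Types (y z : X) (u v w : 'rV[R]_n).

Let D0 : D 0. Proof. by apply: ball_D; rewrite enorm0. Qed.

Lemma chart_dist v : D v -> mdist x0 (phi v) = enorm v.
Proof. by move=> Dv; rewrite -phi0 phi_isometry// sub0r enormN. Qed.

(* [u] is the initial velocity of the geodesic from [x0] to [y], read in the
   chart [phi]. *)
Definition log_vector y u : Prop := \forall t \near 0^'+,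
  D (t *: u) /\ geodesic_point x0 y t = phi (t *: u).

(** One point of the geodesic inside the chart determines the initial velocity. For small [s] the
    point at [s] is some [phi w], and the isometry turns the distances along the geodesic into
    equality in the triangle inequality for [0], [w], [v]; hence [w] is [s / t] times [v]. *)
Lemma log_vector_of_point y v t : 0 < t <= 1 -> D v ->
  geodesic_point x0 y t = phi v -> log_vector y (t^-1 *: v).
Proof.
move=> /andP[t0 t1] Dv yv; near=> s.
have s0 : 0 < s by near: s; exact: nbhs_right_gt.
have st : s <= t by near: s; exact: nbhs_right_le.
have s01 : 0 <= s <= 1 by rewrite ltW//= (le_trans st).
have t01 : 0 <= t <= 1 by rewrite ltW.
have sr : s * mdist x0 y < r by near: s; exact: near_right0_ltM.
have [w Dw wE] : exists2 w, D w & phi w = geodesic_point x0 y s.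
  by apply: phi_onto; rewrite geodesic_point_distl.
have vt : enorm v = t * mdist x0 y.
  by rewrite -chart_dist// -yv geodesic_point_distl.
have ws : enorm w = s * mdist x0 y.
  by rewrite -chart_dist// wE geodesic_point_distl.
have vw : enorm (v - w) = (t - s) * mdist x0 y.
  rewrite -phi_isometry// -yv wE geodesic_point_dist// ger0_norm//.
  by rewrite subr_ge0.
have := enorm_collinear t0 vt ws vw; rewrite -scalerA => <-.
by rewrite wE.
Unshelve. all: by end_near. Qed.

Lemma log_vector_exists y : exists u, log_vector y u.
Proof.
have : \forall t \near (0 : R)^'+, (0 < t /\ t <= 1) /\ t * mdist x0 y < r.
  near=> t; split; last by near: t; exact: near_right0_ltM.
  by split; near: t; [exact: nbhs_right_gt|exact: nbhs_right_le].
move=> /filter_ex[t [[t0 t1] tr]].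
have [v Dv vE] : exists2 v, D v & phi v = geodesic_point x0 y t.
  by apply: phi_onto; rewrite geodesic_point_distl// ltW.
exists (t^-1 *: v); apply: log_vector_of_point => //.
by rewrite t0.
Unshelve. all: by end_near. Qed.

Lemma log_vector_chart v : D v -> log_vector (phi v) v.
Proof.
move=> Dv; rewrite -[v in X in log_vector _ X]scale1r -invr1.
by apply: log_vector_of_point; rewrite ?ltr01 ?lexx ?geodesic_point1.
Qed.

Lemma near_log_vector y u : log_vector y u -> \forall t \near 0^'+,
  [/\ 0 < t, t <= 1, D (t *: u) & geodesic_point x0 y t = phi (t *: u)].
Proof.
move=> yu; near=> t.
have [Dt yt] : D (t *: u) /\ geodesic_point x0 y t = phi (t *: u) by near: t.
have t0 : 0 < t by near: t; exact: nbhs_right_gt.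
by split=> //; near: t; exact: nbhs_right_le.
Unshelve. all: by end_near. Qed.

Lemma enorm_log_vector y u : log_vector y u -> enorm u = mdist x0 y.
Proof.
move=> /near_log_vector/filter_ex[t [t0 t1 Dt yt]].
apply: (mulfI (lt0r_neq0 t0)).
rewrite -enormZ_ge0 ?(ltW t0)// -chart_dist// -yt geodesic_point_distl//.
by rewrite ltW.
Qed.

(** At a common small [t] both geodesics are in the chart, so contraction bounds [t] times the left
    side by [t] times the right side. *)
Lemma log_vector_dist_le y z u v : log_vector y u -> log_vector z v ->
  enorm (u - v) <= mdist y z.
Proof.
move=> /near_log_vector yu /near_log_vector zv.
have [t [[t0 t1 Du yt] [_ _ Dv zt]]] := filter_ex (filterI yu zv).
rewrite -(ler_pM2l t0) -enormZ_ge0 ?(ltW t0)// scalerBr -phi_isometry// -yt -zt.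
by rewrite geodesic_point_contraction// ltW.
Qed.

(** For small [s] and [t] the comparison triangle is congruent to the Euclidean triangle [0],
    [s *: u], [t *: v], whose angle at [0] does not depend on [s] and [t]. Cauchy-Schwarz puts the
    cosine in the range where [cos] inverts [acos]. *)
Lemma cos_alexandrov_angle y z u v : y <> x0 -> z <> x0 ->
  log_vector y u -> log_vector z v ->
  cos (alexandrov_angle y x0 z) = dotv u v / (enorm u * enorm v).
Proof.
move=> /eqP yx /eqP zx yu zv.
have u0 : 0 < enorm u by rewrite (enorm_log_vector yu) mdist_gt0 eq_sym.
have v0 : 0 < enorm v by rewrite (enorm_log_vector zv) mdist_gt0 eq_sym.
rewrite /alexandrov_angle.
set c := dotv u v / _.
have -> : limf_esup (fun st : R * R => (comparison_angle
    (geodesic_point x0 y st.1) x0 (geodesic_point x0 z st.2))%:E)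
    (filter_prod (0 : R)^'+ (0 : R)^'+) = (acos c)%:E; last first.
  have uv0 : 0 < enorm u * enorm v by rewrite mulr_gt0.
  rewrite /= acosK// in_itv/= ler_pdivlMr// ler_pdivrMr// mulN1r mul1r.
  by rewrite -ler_norml norm_dotv_le.
apply: limf_esup_near_cst.
exists ([set s | [/\ 0 < s, s <= 1, D (s *: u) &
    geodesic_point x0 y s = phi (s *: u)]],
  [set t | [/\ 0 < t, t <= 1, D (t *: v) &
    geodesic_point x0 z t = phi (t *: v)]]).
  by split; exact: near_log_vector.
move=> [s t] [/= [s0 s1 Ds ys] [t0 t1 Dt zt]].
rewrite /comparison_angle; congr ((acos _)%:E).
rewrite !ys !zt !chart_dist// phi_isometry// sqr_enormB !enormZ_ge0 ?ltW//.
rewrite dotvZl dotvZr /c; field.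
by rewrite !gt_eqF.
Qed.

(** * The mean deficit and the two certificates in terms of log vectors *)

Section deficit.
Context (A : {fset X}) (A_neq0 : A != fset0) (x0A : x0 \notin A).
Context (u : A -> 'rV[R]_n) (log_u : forall a : A, log_vector (val a) (u a)).
Context (w : A -> R) (w_min : minimal_weights u w).

Let p := \sum_a w a *: u a.

Let a_neq_x0 (a : A) : val a <> x0.
Proof. by move=> ax; move: x0A; rewrite -ax (valP a). Qed.

Let a_exists : exists a : A, True.
Proof. by have /fset0Pn[a aA] := A_neq0; exists [` aA]%fset. Qed.

Let deficit_term z v (a : A) : z <> x0 -> log_vector z v ->
  mdist (val a) x0 * cos (alexandrov_angle (val a) x0 z) = dotv (u a) v / enorm v.
Proof.
move=> zx zv; rewrite (cos_alexandrov_angle (@a_neq_x0 a) zx (log_u a) zv).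
have v0 : enorm v != 0.
  by rewrite (enorm_log_vector zv) gt_eqF// mdist_gt0 eq_sym; exact/eqP.
have ua : enorm (u a) != 0.
  by rewrite (enorm_log_vector (log_u a)) gt_eqF// mdist_gt0 eq_sym; exact/eqP.
rewrite metric_sym -(enorm_log_vector (log_u a)); field.
by rewrite ua v0.
Qed.

Let min_term z : R :=
  inf [set mdist a x0 * cos (alexandrov_angle a x0 z) | a in [set` A]].

Let min_term_le z v (a : A) : z <> x0 -> log_vector z v ->
  min_term z <= dotv (u a) v / enorm v.
Proof.
move=> zx zv; rewrite -(deficit_term a zx zv); apply: ge_inf.
  (* [inf] is a lower bound only for a set bounded below; Cauchy-Schwarz provides this crude
     bound. *)
  exists (- \sum_b enorm (u b)) => _ [b /= bA <-].
  have v0 : 0 < enorm v.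
    by rewrite (enorm_log_vector zv) mdist_gt0 eq_sym; exact/eqP.
  have := deficit_term [` bA]%fset zx zv => /= ->.
  apply: (@le_trans _ _ (- enorm (u [` bA]%fset))).
    by rewrite lerN2 (bigD1 [` bA]%fset)//= lerDl sumr_ge0// => i _; exact: enorm_ge0.
  rewrite ler_pdivlMr// mulNr lerNl -dotvNl -(enormN (u _)).
  exact: dotv_le_enorm.
by exists (val a) => //=; exact: valP.
Qed.

Let le_min_term z v c : z <> x0 -> log_vector z v ->
  (forall a : A, c <= dotv (u a) v / enorm v) -> c <= min_term z.
Proof.
move=> zx zv cle; have [a _] := a_exists; apply: lb_le_inf.
  by exists (mdist (val a) x0 * cos (alexandrov_angle (val a) x0 z)), (val a) => //=;
    exact: valP.
by move=> _ [b /= bA <-]; have := cle [` bA]%fset; rewrite -(deficit_term _ zx zv).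
Qed.

(** A minimum is at most the average with weights [w], which is [dotv p v / enorm v]. *)
Let min_term_le_enorm z : z <> x0 -> min_term z <= enorm p.
Proof.
move=> zx; have [v zv] := log_vector_exists z; have [[w0 w1] _] := w_min.
have v0 : 0 < enorm v.
  by rewrite (enorm_log_vector zv) mdist_gt0 eq_sym; exact/eqP.
apply: (@le_trans _ _ (dotv p v / enorm v)); last first.
  by rewrite ler_pdivrMr// dotv_le_enorm.
rewrite -[leLHS]mul1r -w1 mulr_suml dotv_suml mulr_suml; apply: ler_sum => a _.
by rewrite dotvZl -mulrA ler_wpM2l// min_term_le.
Qed.

Lemma mean_deficit_enorm : mean_deficit A x0 = enorm p.
Proof.
have [a _] := a_exists.
rewrite /mean_deficit -/min_term; set S := [set _ | _ in _].
have Sub : ubound S (enorm p) by move=> _ [z zx <-]; exact: min_term_le_enorm.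
have S0 : S !=set0 by exists (min_term (val a)), (val a) => //; exact: a_neq_x0.
have supS : sup S <= enorm p by exact: ge_sup.
(* If [p] vanishes, the supremum is at most 0 and the positive part makes the deficit exactly 0. *)
have [p0|p0] := eqVneq (enorm p) 0; first by rewrite p0 in supS *; exact/max_r.
have {p0} : 0 < enorm p by rewrite lt0r p0 enorm_ge0.
move=> p0; apply/eqP; rewrite eq_le ge_max supS enorm_ge0/= le_max.
(* The supremum is reached in the direction of [p]. Scaling [p] to norm [r / 2] keeps the witness in
   the chart and away from [x0]; the variational inequality then bounds every term below by
   [enorm p]. *)
apply/orP; left; pose c := r / 2 / enorm p.
have c0 : 0 < c by rewrite !divr_gt0.
have cp : enorm (c *: p) = r / 2.
  by rewrite enormZ_ge0 ?(ltW c0)// divfK// gt_eqF.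
have Dcp : D (c *: p) by apply: ball_D; rewrite cp ltr_pdivrMr// ltr_pMr// ltr1n.
have zx : phi (c *: p) <> x0.
  apply/eqP; rewrite eq_sym -mdist_gt0 chart_dist// cp divr_gt0//.
apply: (@le_trans _ _ (min_term (phi (c *: p)))); last first.
  by apply: ub_le_sup; [exists (enorm p)|exists (phi (c *: p))].
apply: (le_min_term zx (log_vector_chart Dcp)) => b.
rewrite enormZ_ge0 ?(ltW c0)// dotvZr -mulf_div divff ?gt_eqF// mul1r.
by rewrite ler_pdivlMr// -expr2 minimal_weights_dotv.
Qed.

Lemma certifies_mean_of_log_sum0 : p = 0 -> certifies_mean x0 w.
Proof.
move=> p0; have [[w0 w1] _] := w_min; split; first by [].
move=> y; have [v yv] := log_vector_exists y.
apply: (@le_trans _ _ (\sum_(a : A) w a * enorm (u a - v) ^+ 2)); last first.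
  apply: ler_sum => a _; rewrite ler_wpM2l// ler_sqr ?nnegrE ?enorm_ge0 ?mdist_ge0//.
  exact: log_vector_dist_le.
have -> : \sum_(a : A) w a * enorm (u a - v) ^+ 2 =
    \sum_(a : A) w a * mdist (val a) x0 ^+ 2 + enorm v ^+ 2 - 2 * dotv p v.
  have -> : enorm v ^+ 2 = \sum_a w a * enorm v ^+ 2 by rewrite -mulr_suml w1 mul1r.
  rewrite dotv_suml mulr_sumr -big_split/= -sumrB; apply: eq_bigr => a _.
  by rewrite sqr_enormB dotvZl metric_sym (enorm_log_vector (log_u a)); ring.
by rewrite p0 dot0v mulr0 subr0 lerDl sqr_ge0.
Qed.

(** A point [a] may lie outside the chart, so its distance to [phi (s *: p)] is bounded through the
    point at parameter [e] of the geodesic from [x0] to [a], which is in the chart. It remains to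
    compare [e *: u a - s *: p] with [e *: u a]. *)
Lemma near_certifies_not_mean : 0 < enorm p ->
  \forall s \near 0^'+, D (s *: p) /\ certifies_not_mean A x0 (phi (s *: p)).
Proof.
move=> p0.
have nearD : \forall s \near 0^'+, D (s *: p).
  near=> s; apply: ball_D.
  by rewrite enormZ_ge0; near: s; [exact: near_right0_ltM|exact: nbhs_right_ge].
have : \forall s \near 0^'+, forall a : A, mdist (val a) (phi (s *: p)) < mdist (val a) x0.
  apply: filter_forall => a.
  have [e [e0 e1 De ae]] := filter_ex (near_log_vector (log_u a)).
  have k0 : 0 < dotv (u a) p.
    by apply: lt_le_trans (minimal_weights_dotv a w_min); rewrite exprn_gt0.
  near=> s.
  have s0 : 0 < s by near: s; exact: nbhs_right_gt.
  have Ds : D (s *: p) by near: s.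
  (* This is the condition for subtracting [s *: p] to shorten [e *: u a]; the right side is
     positive by the variational inequality. *)
  have sk : s * enorm p ^+ 2 < 2 * e * dotv (u a) p.
    by near: s; apply: near_right0_ltM; rewrite !mulr_gt0.
  have e01 : 0 <= e <= 1 by rewrite ltW.
  apply: le_lt_trans (metric_triangle _ (geodesic_point x0 (val a) e) _) _.
  rewrite geodesic_point_distr// ae phi_isometry// [ltRHS]metric_sym.
  rewrite mulrBl mul1r -addrA gtrDl addrC subr_lt0.
  rewrite -(enorm_log_vector (log_u a)).
  rewrite -enormZ_ge0 ?(ltW e0)// -ltr_sqr ?nnegrE ?enorm_ge0//.
  rewrite sqr_enormB -addrA gtrDl subr_lt0 dotvZl dotvZr (enormZ_ge0 _ (ltW s0)).
  rewrite exprMn expr2 -mulrA mulrCA; nra.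
move=> h; near=> s; split; first by near: s.
move=> a aA; have : forall a : A, mdist (val a) (phi (s *: p)) < mdist (val a) x0.
  by near: s.
by move/(_ [` aA]%fset).
Unshelve. all: by end_near. Qed.

End deficit.

End euclidean_chart.

(** * Unit cubes in edge coordinates *)

Section unit_cubes.
Context {R : realType} (Q : unit_cube R).
Implicit Types (s : 'rV[R]_(cube_dim Q)) (u v : 'rV[R]_(cube_amb Q)).

Definition cube_point s : 'rV[R]_(cube_amb Q) :=
  cube_origin Q + s *m cube_edges Q.

Lemma cube_point_inj : injective cube_point.
Proof.
move=> s t /addrI /(congr1 (mulmx^~ (cube_edges Q)^T)).
by rewrite -!mulmxA !cube_orthonormal !mulmx1.
Qed.

Lemma cube_pointD s t : cube_point (s + t) = cube_point s + t *m cube_edges Q.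
Proof. by rewrite /cube_point mulmxDl addrA. Qed.

Lemma enorm_cube_pointB s t : enorm (cube_point s - cube_point t) = enorm (s - t).
Proof.
rewrite /cube_point opprD addrACA subrr add0r -mulmxBl.
exact: enorm_mulmx (cube_orthonormal Q).
Qed.

Lemma cube_face_point (J : 'I_(cube_dim Q) -> option bool) s :
  cube_face J (cube_point s) <->
  forall i, 0 <= s 0 i <= 1 /\ (forall b : bool, J i = Some b -> s 0 i = b%:R).
Proof. by split=> [[t tJ /cube_point_inj <-]//|sJ]; exists s. Qed.

Lemma cube_set_point s : cube_set (cube_point s) <-> forall i, 0 <= s 0 i <= 1.
Proof.
rewrite /cube_set cube_face_point.
by split=> [h i|h i]; [case: (h i)|split].
Qed.

Lemma cube_setP u : cube_set u -> exists s, u = cube_point s.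
Proof. by move=> [s _ <-]; exists s. Qed.

Lemma relint_cube_margin s : relint (cube_set (Q := Q)) (cube_point s) ->
  exists2 r, 0 < r & forall i, r <= s 0 i <= 1 - r.
Proof.
move=> [sQ [e e0 eQ]]; exists (e / 2) => [|i]; first by rewrite divr_gt0.
have step (c : R) : `|c| < e -> 0 <= s 0 i + c <= 1.
  move=> ce; pose t := s + c *: delta_mx 0 i.
  have /cube_set_point /(_ i) : cube_set (cube_point t).
    apply: eQ; last first.
      rewrite enorm_cube_pointB /t addrC addKr enormZ enormE.
      rewrite (_ : dotv _ _ = 1) ?sqrtr1 ?mulr1//.
      rewrite dotvv (bigD1 i)//= mxE !eqxx expr1n big1 ?addr0// => j ji.
      by rewrite mxE (negbTE ji) andbF expr0n.
    (* A step of size [c] along the i-th edge stays in the affine hull: it adds [c] times the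
       difference of two vertices of the cube. *)
    exists 3, (fun k => nth 0 [:: cube_point s; cube_point (delta_mx 0 i); cube_point 0] k),
      (fun k => nth 0 [:: 1; c; - c] k).
    split.
    - move=> [[|[|[|//]]] ?] //=; apply/cube_set_point => j; rewrite mxE ?lexx ?ler01//.
      by rewrite eqxx/=; case: eqP => _; rewrite ?lexx ?ler01.
    - by rewrite !big_ord_recl big_ord0/= addr0 subrr addr0.
    - rewrite !big_ord_recl big_ord0/= addr0 scale1r scaleNr -scalerBr /cube_point.
      rewrite mul0mx addr0 [_ + _ *m _ - _]addrC addKr -addrA; congr (_ + _).
      by rewrite /t mulmxDl scalemxAl.
  by rewrite !mxE !eqxx mulr1.
have e2 : 0 < e / 2 by rewrite divr_gt0.
have := step (e / 2); have := step (- (e / 2)); rewrite normrN gtr0_norm//.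
have -> : e / 2 < e by lra.
by move=> /(_ isT)/andP[h1 _] /(_ isT)/andP[_ h2]; lra.
Qed.

End unit_cubes.

(** * Neighbourhoods of interior points of a maximal cell *)

Section maximal_cell.
Context {R : realType} {X : metricType R} (K : cat0_cubical_complex X).
Implicit Types (C D : set X) (x y : X).

Lemma cell_chart_inj C (u v : 'rV[R]_(cube_amb (cell_cube K C))) :
  cells K C -> cube_set u -> cube_set v ->
  cell_chart (c := K) (C := C) u = cell_chart (c := K) v -> u = v.
Proof.
move=> KC Qu Qv uv; apply/eqP; rewrite -subr_eq0; apply/eqP/enorm_eq0.
by rewrite -(cell_chart_isometry KC)// uv mdistxx.
Qed.

Lemma cell_coord_chart C (u : 'rV[R]_(cube_amb (cell_cube K C))) :
  cells K C -> cube_set u -> cell_coord K C (cell_chart (c := K) u) = u.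
Proof.
move=> KC Qu; apply: xget_unique => [//|v [Qv vu]].
exact: cell_chart_inj KC Qv Qu vu.
Qed.

Lemma string_length_ge0 x y l :
  string_length (cells K) (cell_chart (c := K)) x y l -> 0 <= l.
Proof. by elim=> // C u v z m _ _ _ _ m0; rewrite addr_ge0// enorm_ge0. Qed.

Context (C : set X) (C_max : maximal_cell K C).
Let KC : cells K C := C_max.1.
Let Q := cell_cube K C.
Let chart : 'rV[R]_(cube_amb Q) -> X := cell_chart (c := K) (C := C).

(** [C] and [D] meet along a face of [C]. A face containing a point with all coordinates strictly
    between 0 and 1 fixes no coordinate, so it is all of [C]; then [D] contains [C] and maximality
    applies. *)
Lemma maximal_cell_interior D (s : 'rV[R]_(cube_dim Q)) :
  cells K D -> (forall i, 0 < s 0 i < 1) -> D (chart (cube_point s)) -> D = C.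
Proof.
move=> KD s01 Ds; apply: C_max.2 => //.
have Qs : cube_set (cube_point s).
  by apply/cube_set_point => i; have /andP[s0 s1] := s01 i; rewrite !ltW.
have Cs : C (chart (cube_point s)).
  by rewrite -[X in X _](cell_chart_image KC); exists (cube_point s).
have [CD|[J [_ [CD _]]]] := cells_glue KC KD.
  by have : (C `&` D) (chart (cube_point s)) by []; rewrite CD.
have : (C `&` D) (chart (cube_point s)) by [].
rewrite CD => -[u Ju us].
have Qu : cube_set u.
  have [t tJ tu] := Ju; rewrite -tu; apply/cube_set_point => i.
  by have [] := tJ i.
have us' := cell_chart_inj KC Qu Qs us.
have Jnone i : J i = None.
  move: Ju; rewrite us' => /cube_face_point /(_ i) [_].
  case: (J i) => // b /(_ b erefl) sb; have := s01 i; rewrite sb.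
  by case: b {sb}; rewrite ltxx ?andbF.
have JE : cube_face J = cube_set (Q := Q).
  by rewrite /cube_set; congr cube_face; exact/funext.
by move=> y Cy; apply: (@subIsetr _ C); rewrite CD JE (cell_chart_image KC).
Qed.

(* A string that starts at depth [r] inside a maximal cell has to travel a
   length at least [r] before it can use another cell. *)
Lemma string_stays_in_cell x y l :
  string_length (cells K) (cell_chart (c := K)) x y l ->
  forall (s : 'rV[R]_(cube_dim Q)) r, (forall i, r <= s 0 i <= 1 - r) ->
    l < r -> x = chart (cube_point s) -> C y.
Proof.
elim=> {x y l} [x|D u v y l KD Qu Qv str IH] s r sr lr xs.
  rewrite -(cell_chart_image KC) xs; exists (cube_point s) => //.
  by apply/cube_set_point => i; have := sr i; lra.
have l0 := string_length_ge0 str; have uv0 := enorm_ge0 (u - v).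
have s01 i : 0 < s 0 i < 1 by have := sr i; lra.
have DC : D = C.
  apply: (maximal_cell_interior KD s01); rewrite -xs -[X in X _](cell_chart_image KD).
  by exists u.
subst D.
have Qs : cube_set (cube_point s) by apply/cube_set_point => i; have := s01 i; lra.
have us := cell_chart_inj KC Qu Qs xs.
have [t vt] := cube_setP Qv.
(* The depth left after the first link: no coordinate moves by more than the Euclidean length of the
   link. *)
apply: (IH t (r - enorm (u - v))); [|lra|by rewrite vt].
move=> i; rewrite us vt enorm_cube_pointB.
have := enorm_coord (s - t) i; rewrite !mxE ler_norml; have := sr i; lra.
Qed.

(** The distance is an infimum of string lengths, so a distance below [r] yields a string shorter
    than [r]. *)
Lemma ball_in_maximal_cell (s : 'rV[R]_(cube_dim Q)) r y :
  (forall i, r <= s 0 i <= 1 - r) -> mdist (chart (cube_point s)) y < r -> C y.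
Proof.
move=> sr; rewrite -lte_fin (metric_intrinsic K) => /ereal_inf_lt[_ [l str <-]].
by rewrite lte_fin => lr; exact: string_stays_in_cell str s r sr lr erefl.
Qed.

End maximal_cell.

(** * Certificates against the mean, and the deficit formula in a maximal cell *)

Lemma certifies_not_mean_notin (R : realType) (X : metricType R)
    (A : {fset X}) (x y : X) : certifies_not_mean A x y -> ~ mean A x.
Proof.
move=> Axy [w [[w0 w1] /(_ y) wle]].
(* These terms are nonnegative with sum at most 0, so all vanish; as the differences are positive,
   every weight is 0, against their sum being 1. *)
pose F (a : A) := w a * (mdist (val a) x ^+ 2 - mdist (val a) y ^+ 2).
have sq_lt (a : A) : mdist (val a) y ^+ 2 < mdist (val a) x ^+ 2.
  by rewrite ltr_sqr ?nnegrE ?mdist_ge0//; exact/Axy/valP.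
have F0 a : 0 <= F a.
  by rewrite mulr_ge0// subr_ge0 ltW.
have /psumr_eq0P : \sum_a F a = 0.
  apply/eqP; rewrite eq_le sumr_ge0// andbT.
  by under eq_bigr do rewrite /F mulrBr; rewrite sumrB subr_le0.
move=> /(_ (fun a _ => F0 a)) Fa0; have /eqP := oner_eq0 R; apply.
rewrite -w1 big1// => a _; have /eqP := Fa0 a isT.
by rewrite mulf_eq0 subr_eq0 (gt_eqF (sq_lt a)) orbF => /eqP.
Qed.

Theorem theorem9p3 (R : realType) (X : metricType R)
    (K : cat0_cubical_complex X) (A : {fset X}) (xbar : X) (C : set X) :
  A != fset0 -> xbar \notin A ->
  maximal_cell K C -> cell_relint K C xbar ->
  (forall a : A, \forall t \near 0^'+, C (geodesic_point xbar (val a) t)) /\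
  (forall t : A -> R,
    (forall a, 0 < t a <= 1) ->
    (forall a, C (geodesic_point xbar (val a) (t a))) ->
    let xi := cell_coord K C xbar in
    let z (a : A) : 'rV[R]_(cube_amb (cell_cube K C)) :=
      xi + (t a)^-1 *:
        (cell_coord K C (geodesic_point xbar (val a) (t a)) - xi) in
    let feasible (y : 'rV[R]_(cube_amb (cell_cube K C))) (w : A -> R) :=
      simplex w /\ y = \sum_(a : A) w a *: z a in
    let objective := [set r : R | exists y w,
      feasible y w /\ r = enorm (y - xi)] in
    (objective (mean_deficit A xbar) /\
     lbound objective (mean_deficit A xbar)) /\
    (forall zhat what,
      feasible zhat what ->
      (forall y w, feasible y w -> enorm (zhat - xi) <= enorm (y - xi)) ->
      (mean_deficit A xbar = 0 ->
        mean A xbar /\ certifies_mean xbar what) /\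
      (0 < mean_deficit A xbar ->
        ~ mean A xbar /\
        \forall s \near 0^'+,
          cube_set (Q := cell_cube K C) ((1 - s) *: xi + s *: zhat) /\
          certifies_not_mean A xbar
            (cell_chart (c := K) (C := C) ((1 - s) *: xi + s *: zhat))))).
Proof.
move=> A0 xA C_max [u0 u0_int u0E]; have [KC _] := C_max.
have HX := complex_hadamard K.
have [s0 s0E] := cube_setP u0_int.1.
subst u0; have [r r0 s0r] := relint_cube_margin u0_int.
(* Edge coordinates replace ambient ones: the cube may have lower dimension than [E], and only in
   its own dimension does it contain a ball around [xbar]. *)
pose D (v : 'rV[R]_(cube_dim (cell_cube K C))) := cube_set (cube_point (s0 + v)).
pose phi v : X := cell_chart (c := K) (C := C) (cube_point (s0 + v)).
have phi0 : phi 0 = xbar by rewrite /phi addr0.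
have ball_D v : enorm v < r -> D v.
  move=> vr; apply/cube_set_point => i; rewrite mxE.
  by have := enorm_coord v i; rewrite ler_norml; have := s0r i; lra.
have phi_iso v w : D v -> D w -> mdist (phi v) (phi w) = enorm (v - w).
  move=> Dv Dw; rewrite cell_chart_isometry// enorm_cube_pointB.
  by rewrite opprD addrACA subrr add0r.
have CE y : C y -> exists2 v, D v & phi v = y.
  rewrite -[X in X y](cell_chart_image KC) => -[u Qu uy].
  have [s sE] := cube_setP Qu; exists (s - s0); rewrite /D /phi addrC subrK -sE//.
have ballC y : mdist xbar y < r -> C y.
  by rewrite -u0E; exact: ball_in_maximal_cell C_max s0 r y s0r.
have phi_onto y : mdist xbar y < r -> exists2 v, D v & phi v = y.
  by move=> /ballC /CE.
split.
  move=> a; near=> t; apply: ballC; rewrite geodesic_point_distl//.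
    by near: t; exact: near_right0_ltM.
  by apply/andP; split; near: t; [exact: nbhs_right_ge|exact: nbhs_right_le].
move=> t t01 Ct xi z feasible objective.
have v_ex (a : A) : exists v, D v /\ phi v = geodesic_point xbar (val a) (t a).
  by have [v] := CE _ (Ct a); exists v.
have [v vP] := choice v_ex.
pose u a := (t a)^-1 *: v a.
have log_u a : log_vector xbar D phi (val a) (u a).
  have [Dv vE] := vP a.
  exact: (log_vector_of_point HX r0 phi0 ball_D phi_iso phi_onto (t01 a) Dv).
have coordE w : D w -> cell_coord K C (phi w) = cube_point (s0 + w).
  exact: cell_coord_chart.
have xiE : xi = cube_point s0.
  by rewrite /xi -phi0 coordE ?addr0//; apply: ball_D; rewrite enorm0.
have zE a : z a = cube_point (s0 + u a).
  have [Dv vE] := vP a; rewrite /z -vE coordE// xiE !cube_pointD.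
  by rewrite (addrC _ (v a *m _)) addrK scalemxAl.
(* Weights of sum 1 commute with the affine map [cube_point], and this map is an isometry. Feasible
   points [z] thus correspond to convex combinations of log vectors, with [z - xi] of the same
   norm. *)
have hullE (w : A -> R) : simplex w ->
    \sum_a w a *: z a = cube_point (s0 + \sum_a w a *: u a).
  move=> [_ w1]; under eq_bigr do rewrite zE cube_pointD scalerDr.
  rewrite big_split/= -scaler_suml w1 scale1r cube_pointD mulmx_suml.
  by congr (_ + _); apply: eq_bigr => a _; rewrite scalemxAl.
have enormE y w : feasible y w -> enorm (y - xi) = enorm (\sum_a w a *: u a).
  by move=> [Sw ->]; rewrite hullE// xiE enorm_cube_pointB addrC addKr.
have deficitE w : minimal_weights u w ->
    mean_deficit A xbar = enorm (\sum_a w a *: u a).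
  exact: (mean_deficit_enorm HX r0 phi0 ball_D phi_iso phi_onto A0 xA log_u).
have [a0 _] : exists a : A, True.
  by have /fset0Pn[a aA] := A0; exists [` aA]%fset.
split.
  have [w w_min] := minimal_weights_exist u a0.
  have Sw := w_min.1; rewrite (deficitE _ w_min); split.
    have fw : feasible (\sum_a w a *: z a) w by [].
    by exists (\sum_a w a *: z a), w; split=> //; rewrite (enormE _ _ fw).
  move=> _ [y [w' [fw' ->]]]; rewrite (enormE _ _ fw').
  by apply: w_min.2; exact: fw'.1.
move=> zhat w fw w_opt.
have w_min : minimal_weights u w.
  split=> [|w' Sw']; first exact: fw.1.
  have fw' : feasible (\sum_a w' a *: z a) w' by [].
  by rewrite -(enormE _ _ fw) -(enormE _ _ fw'); exact: w_opt fw'.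
rewrite (deficitE _ w_min); split.
  move=> /enorm_eq0 p0; suff cw : certifies_mean xbar w by split=> //; exists w.
  exact: (certifies_mean_of_log_sum0 HX r0 phi0 ball_D phi_iso phi_onto log_u w_min p0).
move=> p0.
have near_p : \forall s \near 0^'+, D (s *: \sum_a w a *: u a) /\
    certifies_not_mean A xbar (phi (s *: \sum_a w a *: u a)).
  exact: (near_certifies_not_mean HX r0 phi0 ball_D phi_iso log_u w_min p0).
split.
  have [s [_ cs]] := filter_ex near_p; exact: certifies_not_mean_notin cs.
(* The segment from [xi] to [zhat] in [E] is the ray along the least-norm vector in edge
   coordinates. *)
have pE s : (1 - s) *: xi + s *: zhat = cube_point (s0 + s *: \sum_a w a *: u a).
  rewrite fw.2 hullE ?xiE; last exact: fw.1.
  by rewrite !cube_pointD (scalerDr s) addrA -scalerDl subrK scale1r scalemxAl.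
near=> s; rewrite pE; near: s; exact: near_p.
Unshelve. all: by end_near. Qed.
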